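(* For all $x,y\in\mathbb{B}^n$, $$\tilde c_{\mathbb{B}^n}(x,y)=\begin{cases}\dfrac{|x-y|}{1-\min\{|x|,|y|\}} & \text{if } \cos(\mu)\ge\dfrac{\big||x|^2-|y|^2\big|+2\min\{|x|,|y|\}}{2\max\{|x|,|y|\}},\\[2ex] \dfrac{|x-y|}{\sqrt{1+|x|^2-2|x|\cos(k)}} & \text{otherwise,}\end{cases}$$ where $\mu$ is the magnitude of the angle $\measuredangle XOY$ and $k\in(0,\mu)$ is chosen so that $|x|\cos(k)-|y|\cos(\mu-k)=(|x|^2-|y|^2)/2$.
   Context: $|\cdot|$ is the Euclidean norm and $\mathbb{B}^n=\{x\in\mathbb{R}^n:|x|<1\}$ is the unit ball. For a domain $G\subsetneq\mathbb{R}^n$ with boundary $\partial G$ and $x,y\in G$, $$\tilde c_G(x,y)=\frac{|x-y|}{\inf_{z\in\partial G}\max\{|x-z|,|y-z|\}}.$$ For two distinct points $x,y\in\mathbb{R}^n\setminus\{0\}$, $\measuredangle XOY$ denotes the magnitude of the angle formed between the vectors from the origin to the points $x$ and $y$, taken so that $\measuredangle XOY\le\pi$.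
   Formalization: The formal theorem assumes n ≥ 2; for n = 1 the formula fails, e.g. x = 1/2, y = -1/2 gives 1/√(5/4) by the second case, while the true value is 2/3. *)

(* Defs.v *)
From HB Require Import structures.
From mathcomp Require Import all_boot all_order all_algebra.
From mathcomp Require Import all_classical all_reals all_analysis.
Set Implicit Arguments.
Unset Strict Implicit.
Unset Printing Implicit Defensive.
Import Order.TTheory GRing.Theory Num.Theory.
Import numFieldNormedType.Exports.
Local Open Scope classical_set_scope.
Local Open Scope ring_scope.

Definition dot (R : realType) (n : nat) (x y : 'rV[R]_n) : R :=
  \sum_(i < n) x ord0 i * y ord0 i.

(* The library norm `|x| on 'rV[R]_n is the sup norm, hence this definition;
   the library topology on 'rV[R]_n is the usual one of R^n. *)
Definition enorm (R : realType) (n : nat) (x : 'rV[R]_n) : R :=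
  Num.sqrt (dot x x).

Definition unit_ball (R : realType) (n : nat) : set 'rV[R]_n :=
  [set x | enorm x < 1].

Definition boundary (T : topologicalType) (G : set T) : set T :=
  closure G `\` interior G.

Definition tilde_c (R : realType) (n : nat) (G : set 'rV[R]_n)
    (x y : 'rV[R]_n) : R :=
  enorm (x - y) /
  inf [set Num.max (enorm (x - z)) (enorm (y - z)) | z in boundary G].

(* The angle at the origin between x and y, in [0, pi]. If x or y is 0, where
   the angle is undefined, this is acos (_ / 0) = acos 0 = pi / 2. *)
Definition angle (R : realType) (n : nat) (x y : 'rV[R]_n) : R :=
  acos (dot x y / (enorm x * enorm y)).

(* Main.v *)
(* A point of the arc from [x / |x|] to [y / |y|] is a positive combination of the
   two directions, so by Cauchy-Schwarz no point of the sphere is strictly closer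
   to both [x] and [y]. If the interior of the arc contains a point equidistant
   from [x] and [y], the infimum is therefore attained there. Otherwise the
   point of the sphere nearest to the shorter vector is at least as close to the
   longer one, and the infimum is attained there. *)
Require Import Defs.
From mathcomp Require Import all_boot all_order all_algebra.
From mathcomp Require Import all_classical all_reals all_analysis.
From mathcomp Require Import ring lra.
Import Order.TTheory GRing.Theory Num.Theory.
Import numFieldNormedType.Exports.
Local Open Scope classical_set_scope.
Local Open Scope ring_scope.

(** * Euclidean inner product and norm *)

Section Dot.
Context {R : realType} {n : nat}.
Implicit Types (x y z u v : 'rV[R]_n) (a b : R).

Lemma dotC x y : dot x y = dot y x.
Proof. by apply: eq_bigr => i _; rewrite mulrC. Qed.

Lemma dotDl x y z : dot (x + y) z = dot x z + dot y z.
Proof. by rewrite -big_split; apply: eq_bigr => i _; rewrite mxE mulrDl. Qed.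

Lemma dotZl a x y : dot (a *: x) y = a * dot x y.
Proof. by rewrite [RHS]mulr_sumr; apply: eq_bigr => i _; rewrite mxE mulrA. Qed.

Lemma dotDr x y z : dot x (y + z) = dot x y + dot x z.
Proof. by rewrite dotC dotDl !(dotC x). Qed.

Lemma dotZr a x y : dot x (a *: y) = a * dot x y.
Proof. by rewrite dotC dotZl dotC. Qed.

Lemma dotNl x y : dot (- x) y = - dot x y.
Proof. by rewrite -scaleN1r dotZl mulN1r. Qed.

Lemma dotNr x y : dot x (- y) = - dot x y.
Proof. by rewrite dotC dotNl dotC. Qed.

Definition dotE := (dotDl, dotDr, dotZl, dotZr, dotNl, dotNr).

Lemma dotxx_ge0 x : 0 <= dot x x.
Proof. by apply: sumr_ge0 => i _; rewrite -expr2 sqr_ge0. Qed.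

Lemma dotxx_eq0 x : (dot x x == 0) = (x == 0).
Proof.
apply/eqP/eqP => [x0|->]; last by apply: big1 => i _; rewrite mxE mul0r.
apply/rowP => i; rewrite mxE; apply/eqP; rewrite -sqrf_eq0 expr2; apply/eqP.
by apply: (psumr_eq0P _ x0) => // j _; rewrite -expr2 sqr_ge0.
Qed.

Lemma enorm_ge0 x : 0 <= enorm x.
Proof. exact: sqrtr_ge0. Qed.

Lemma enorm_eq0 x : (enorm x == 0) = (x == 0).
Proof. by rewrite /enorm sqrtr_eq0 -dotxx_eq0 eq_le dotxx_ge0 andbT. Qed.

Lemma enorm_sqr x : enorm x ^+ 2 = dot x x.
Proof. by rewrite sqr_sqrtr ?dotxx_ge0. Qed.

Lemma enormZ a x : enorm (a *: x) = `|a| * enorm x.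
Proof. by rewrite /enorm !dotE mulrA -expr2 sqrtrM ?sqr_ge0 // sqrtr_sqr. Qed.

Lemma enormB_sqr x z : enorm (x - z) ^+ 2 = dot x x - 2 * dot x z + dot z z.
Proof. by rewrite enorm_sqr !dotE (dotC z x); ring. Qed.

Lemma unit_direction {x} : x != 0 -> exists2 u, dot u u = 1 & x = enorm x *: u.
Proof.
rewrite -enorm_eq0 => x0; exists ((enorm x)^-1 *: x).
  by rewrite !dotE -enorm_sqr; field.
by rewrite scalerA divff // scale1r.
Qed.

(** The residual of [z] after projection to the plane of [u] and [v] has nonnegative square. *)
Lemma bessel {u v} z : dot u u = 1 -> dot v v = 1 -> dot u v = 0 ->
  dot u z ^+ 2 + dot v z ^+ 2 <= dot z z.
Proof.
move=> uu vv uv; have := dotxx_ge0 (z - dot u z *: u - dot v z *: v).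
rewrite !dotE uu vv uv (dotC v u) uv (dotC z u) (dotC z v); nra.
Qed.

(** * The unit sphere as boundary of the ball *)

Lemma dot_continuous : continuous (fun x : 'rV[R]_n => dot x x).
Proof.
apply: continuous_big => [|i _ x]; first exact: add_continuous.
by have xi := @coord_continuous R 1 n ord0 i x; exact: (cvgM xi xi).
Qed.

Lemma enorm_continuous : continuous (@enorm R n).
Proof.
move=> x; apply: (@continuous_comp _ _ _ (fun x => dot x x) Num.sqrt).
  exact: dot_continuous.
exact: sqrt_continuous.
Qed.

Lemma boundary_unit_ball : boundary (@unit_ball R n) = [set z | dot z z = 1].
Proof.
have ball_open : open (@unit_ball R n).
  apply: (@open_comp _ _ (@enorm R n) [set r | r < 1]); last exact: open_lt.
  by move=> x _; exact: enorm_continuous.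
have sphereE z : (dot z z = 1) <-> (enorm z = 1).
  split=> [z1|]; first by rewrite /enorm z1 sqrtr1.
  by rewrite -enorm_sqr => ->; rewrite expr1n.
rewrite /boundary; have /interior_id -> := ball_open.
apply/seteqP; split => z /=.
  move=> [zc /negP]; rewrite /unit_ball /= -leNgt => z1.
  apply/sphereE/le_anti; rewrite z1 andbT.
  have cl : closed [set w : 'rV[R]_n | enorm w <= 1].
    apply: (@preimage_closed _ _ (@enorm R n) [set r | r <= 1]).
      by move=> w _; exact: enorm_continuous.
    exact: closed_le.
  have : closure [set w : 'rV[R]_n | enorm w <= 1] z.
    by apply: closureS zc => w; exact: ltW.
  by rewrite -(closure_id _).1.
move=> /sphereE z1; split; last by rewrite /unit_ball /= z1 ltxx.
(* A sphere point [z] is approached from inside the ball by [t *: z] as [t] tends to 1 from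
   below. *)
move=> B Bz.
have : \forall t \near (1 : R), B (t *: z).
  have := @scalel_continuous _ _ z (1 : R).
  by rewrite /continuous_at scale1r; exact.
move=> /nbhs_ballP[e e0 He].
(* Capping [e] at 1 keeps [t] positive; halving keeps it strictly within [e] of 1. *)
pose t := 1 - Num.min e 1 / 2.
have m0 : 0 < Num.min e 1 by rewrite lt_min e0 ltr01.
have m1 : Num.min e 1 <= 1 by rewrite ge_min lexx orbT.
have me : Num.min e 1 <= e by rewrite ge_min lexx.
exists (t *: z); split.
  rewrite /unit_ball /= enormZ z1 mulr1 ger0_norm /t; lra.
apply: He; rewrite /ball /= /t opprB addrC subrK ger0_norm; lra.
Qed.

(** Reduces the infimum to naming a minimiser [z] on the sphere and bounding the other points
    below. *)
Lemma tilde_c_unit_ball {x y} z {d} : dot z z = 1 ->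
  Num.max (enorm (x - z)) (enorm (y - z)) = d ->
  (forall w, dot w w = 1 -> d <= Num.max (enorm (x - w)) (enorm (y - w))) ->
  tilde_c (@unit_ball R n) x y = enorm (x - y) / d.
Proof.
move=> z1 zd dmin; rewrite /tilde_c boundary_unit_ball; congr (_ / _).
apply/le_anti/andP; split.
  by rewrite -zd; apply: ge_inf; [exists d => _ [w w1 <-]; exact: dmin | exists z].
by apply: lb_le_inf; [exists d, z | move=> _ [w w1 <-]; exact: dmin].
Qed.

(** * Orthonormal frames of the plane through [x] and [y] *)

Lemma exists_orthogonal (hn : (2 <= n)%N) u :
  exists v, dot v v = 1 /\ dot u v = 0.
Proof.
suff [v v0 uv] : exists2 v, v != 0 & dot u v = 0.
  have [w ww vw] := unit_direction v0; exists w; split => //.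
  apply/eqP; move/eqP: uv; rewrite vw dotZr mulf_eq0 enorm_eq0.
  by rewrite (negPf v0).
pose i0 : 'I_n := Ordinal (ltnW hn); pose i1 : 'I_n := Ordinal hn.
have dotd i : dot u (delta_mx ord0 i) = u ord0 i.
  rewrite /dot (bigD1 i) //= mxE !eqxx mulr1 big1 ?addr0 // => j ji.
  by rewrite mxE (negPf ji) andbF mulr0.
have [u0|u0] := eqVneq (u ord0 i0) 0.
  exists (delta_mx ord0 i0); last by rewrite dotd.
  apply/eqP => /rowP/(_ i0); rewrite !mxE !eqxx => /eqP.
  by rewrite oner_eq0.
(* A quarter turn of the first two coordinates of [u]; its entry at [i1] is nonzero. *)
exists (u ord0 i1 *: delta_mx ord0 i0 - u ord0 i0 *: delta_mx ord0 i1).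
  apply/eqP => /rowP/(_ i1); rewrite !mxE !eqxx /= mulr0 mulr1 add0r => /eqP.
  by rewrite oppr_eq0 (negPf u0).
by rewrite !dotE !dotd; ring.
Qed.

(* Any frame works for a vanishing [x] or [y] provided that it
   realises the junk value [angle x y = pi / 2]. *)
Lemma planar_frame (hn : (2 <= n)%N) x y :
  0 <= angle x y <= pi /\
  exists u e, [/\ dot u u = 1, dot e e = 1, dot u e = 0, x = enorm x *: u &
    y = enorm y *: (cos (angle x y) *: u + sin (angle x y) *: e)].
Proof.
have piP := pi_gt0 R.
have enorm0 : enorm (0 : 'rV[R]_n) = 0 by apply/eqP; rewrite enorm_eq0.
have [x0|x0] := eqVneq x 0.
  have -> : angle x y = pi / 2 by rewrite /angle x0 enorm0 mul0r invr0 mulr0 acos0.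
  rewrite cos_pihalf sin_pihalf; split; first lra.
  (* At angle pi / 2 a nonzero [y] has direction [e], and [u] is any unit vector orthogonal to
     it. *)
  have [y0|/unit_direction[e ee ye]] := eqVneq y 0.
    have [e [ee _]] := exists_orthogonal hn 0.
    have [u [uu eu]] := exists_orthogonal hn e.
    by exists u, e; rewrite x0 y0 enorm0 !scale0r dotC; split.
  have [u [uu eu]] := exists_orthogonal hn e.
  exists u, e; rewrite x0 enorm0 dotC; split => //; first by rewrite scale0r.
  by rewrite scale0r scale1r add0r.
have [u uu xu] := unit_direction x0.
have [y0|y0] := eqVneq y 0.
  have -> : angle x y = pi / 2 by rewrite /angle y0 enorm0 mulr0 invr0 mulr0 acos0.
  split; first lra.
  have [e [ee ue]] := exists_orthogonal hn u.
  by exists u, e; split => //; rewrite y0 enorm0 scale0r.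
have [v vv yv] := unit_direction y0.
have -> : angle x y = acos (dot u v).
  rewrite /angle {1}xu {1}yv !dotE mulrA mulrC mulKf //.
  by rewrite mulf_neq0 ?enorm_eq0.
(* Gram-Schmidt: [w] is the part of [v] orthogonal to [u], and its norm is the sine of the angle. *)
have [c cE] : exists c, c = dot u v by exists (dot u v).
have [w wE] : exists w, w = v - c *: u by exists (v - c *: u).
rewrite -cE.
have ww : dot w w = 1 - c ^+ 2.
  by rewrite wE !dotE uu vv (dotC v u) -cE; ring.
have c1 : -1 <= c <= 1.
  by have := dotxx_ge0 w; rewrite ww => c1; apply/andP; split; nra.
have uw : dot u w = 0 by rewrite wE !dotE uu -cE; ring.
have {}wE : v = c *: u + w by rewrite wE addrC subrK.
split; first by rewrite acos_ge0 // acos_lepi.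
rewrite acosK ?in_itv //= sin_acos // -ww -/(enorm w).
have [w0|w0] := eqVneq w 0.
  have [e [ee ue]] := exists_orthogonal hn u.
  by exists u, e; split; rewrite // w0 enorm0 scale0r -{}w0 -wE.
have [e ee we] := unit_direction w0.
exists u, e; split => //; last by rewrite -we -wE.
by apply/eqP; move/eqP: uw; rewrite we dotZr mulf_eq0 enorm_eq0 (negPf w0).
Qed.

(** * The value of [tilde_c] at the two kinds of minimiser *)

Lemma enormBC x y : enorm (x - y) = enorm (y - x).
Proof. by rewrite -opprB -scaleN1r enormZ normrN1 mul1r. Qed.

Lemma tilde_cC (G : set 'rV[R]_n) x y : tilde_c G x y = tilde_c G y x.
Proof.
rewrite /tilde_c enormBC; congr (_ / inf _).
by apply/seteqP; split => _ [z Gz <-]; exists z => //; rewrite maxC.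
Qed.

(* The point of the sphere nearest to [y] attains the infimum as soon as it is
   no farther from [x]. *)
Lemma tilde_c_nearest {x y z} : dot z z = 1 -> y = enorm y *: z -> enorm y < 1 ->
  enorm (x - z) <= 1 - enorm y ->
  tilde_c (@unit_ball R n) x y = enorm (x - y) / (1 - enorm y).
Proof.
move=> zz yz y1 xz.
have y0 := enorm_ge0 y.
apply: (tilde_c_unit_ball z) => // [|w ww].
  have -> : enorm (y - z) = 1 - enorm y.
    rewrite {1}yz -{2}(scale1r z) -scalerBl enormZ {2}/enorm zz sqrtr1 mulr1.
    by rewrite distrC ger0_norm; lra.
  exact: max_r.
(* The distance from [y] alone suffices: no point of the sphere is closer to [y] than
   [1 - enorm y]. *)
rewrite le_max; apply/orP; right.
rewrite -(ler_pXn2r (n:=2)) // ?nnegrE ?enorm_ge0 //; last lra.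
rewrite enormB_sqr -enorm_sqr {3}yz dotZl ww.
have zw : dot z w <= 1.
  by have := dotxx_ge0 (z - w); rewrite !dotE zz ww (dotC w z); lra.
have : enorm y * dot z w <= enorm y * 1 by exact: ler_wpM2l.
rewrite sqrrB expr1n mul1r; lra.
Qed.

(* [z] lies at angle [k] from [x] and [mu - k] from [y], and the choice of [k]
   makes it equidistant from both. *)
Lemma tilde_c_equidistant {x y u e mu k} :
  dot u u = 1 -> dot e e = 1 -> dot u e = 0 -> x = enorm x *: u ->
  y = enorm y *: (cos mu *: u + sin mu *: e) ->
  0 < k < mu -> mu <= pi ->
  enorm x * cos k - enorm y * cos (mu - k) = (enorm x ^+ 2 - enorm y ^+ 2) / 2 ->
  tilde_c (@unit_ball R n) x y =
    enorm (x - y) / Num.sqrt (1 + enorm x ^+ 2 - 2 * enorm x * cos k).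
Proof.
move=> uu ee ue xu ye /andP[k0 kmu] mupi kP.
have cs t : cos t ^+ 2 + sin t ^+ 2 = 1 :> R by exact: cos2Dsin2.
have dotx w : dot x w = enorm x * dot u w by rewrite {1}xu dotZl.
have doty w : dot y w = enorm y * (cos mu * dot u w + sin mu * dot e w).
  by rewrite {1}ye !dotE.
have [z zE] : exists z, z = cos k *: u + sin k *: e by eexists.
have uz : dot u z = cos k by rewrite zE !dotE uu ue; ring.
have ez : dot e z = sin k by rewrite zE !dotE ee dotC ue; ring.
have zz : dot z z = 1 by rewrite {1}zE !dotE uz ez -!expr2 cs.
have xz : enorm (x - z) ^+ 2 = 1 + enorm x ^+ 2 - 2 * enorm x * cos k.
  by rewrite enormB_sqr -enorm_sqr dotx uz zz; ring.
have yz : enorm (y - z) ^+ 2 = 1 + enorm y ^+ 2 - 2 * enorm y * cos (mu - k).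
  by rewrite enormB_sqr -enorm_sqr doty uz ez zz cosB; ring.
(* The equation for [k] says exactly that the two squared distances agree. *)
have eqd : enorm (x - z) = enorm (y - z).
  apply/eqP; rewrite -(eqrXn2 (n:=2)) ?enorm_ge0 // xz yz; apply/eqP; lra.
rewrite -xz sqrtr_sqr ger0_norm ?enorm_ge0 //.
apply: (tilde_c_unit_ball z) => // [|w ww]; first by rewrite -eqd maxxx.
(* Suppose that [w] is strictly closer than [z] to both [x] and [y]; then it has a larger inner
   product than [z] with both directions. *)
rewrite leNgt gt_max; apply/negP => /andP[].
have sqr_lt v v' : enorm v < enorm v' -> enorm v ^+ 2 < enorm v' ^+ 2.
  by rewrite ltr_pXn2r // nnegrE enorm_ge0.
rewrite {2}eqd => /sqr_lt + /sqr_lt; rewrite xz yz !enormB_sqr ww -!enorm_sqr dotx doty => xw yw.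
have x0 := enorm_ge0 x; have y0 := enorm_ge0 y.
have {}xw : cos k < dot u w.
  rewrite ltNge; apply/negP => /(ler_wpM2l x0); lra.
have {}yw : cos (mu - k) < cos mu * dot u w + sin mu * dot e w.
  rewrite ltNge; apply/negP => /(ler_wpM2l y0); lra.
have sk : 0 < sin k by apply: sin_gt0_pi; lra.
have smk : 0 < sin (mu - k) by apply: sin_gt0_pi; lra.
have smu : 0 <= sin mu by apply: sin_ge0_pi; lra.
have w1 : cos k * dot u w + sin k * dot e w <= 1.
  have := bessel w uu ee ue; rewrite ww => wb.
  have := sqr_ge0 (cos k - dot u w); have := sqr_ge0 (sin k - dot e w).
  by have := cs k; rewrite !sqrrB; lra.
(* With [v] the direction of [y], [sin mu *: z = sin (mu - k) *: u + sin k *: v], with positive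
   coefficients on the right. Pairing this with [z] gives [skE], with [w] gives [swE]; the strict
   inequalities then contradict [w1]. *)
have skE : sin mu = sin (mu - k) * cos k + sin k * cos (mu - k).
  by rewrite -[LHS]mulr1 -(cs k) sinB cosB; ring.
have swE : sin mu * (cos k * dot u w + sin k * dot e w) =
    sin (mu - k) * dot u w + sin k * (cos mu * dot u w + sin mu * dot e w).
  by rewrite sinB; ring.
have : sin mu * (cos k * dot u w + sin k * dot e w) <= sin mu * 1.
  exact: ler_wpM2l.
rewrite swE mulr1 {2}skE leNgt ltrD // ltr_pM2l //.
Qed.

End Dot.

(** * The threshold for [cos mu] and the existence of [k] *)

(** The conclusion is the squared form of the distance bound in [tilde_c_nearest]. If [a = 0], then
    [b = 0] and it reads [0 <= 0]. *)
Lemma ler_threshold {R : realFieldType} {a b c : R} : 0 <= b -> b <= a ->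
  (`|a ^+ 2 - b ^+ 2| + 2 * b) / (2 * a) <= c -> a ^+ 2 - b ^+ 2 + 2 * b <= 2 * a * c.
Proof.
move=> b0 ba; have [a0|a0] : a = 0 \/ 0 < a.
- have [->|a0] := eqVneq a 0; first by left.
  by right; rewrite lt_def a0 (le_trans b0).
- have -> : b = 0 by lra.
  by rewrite a0; lra.
- by rewrite ger0_norm ?ler_pdivrMr ?mulr_gt0 // ?(mulrC c); nra.
Qed.

(** With [c = cos mu], this puts the target value strictly between those of
    [a * cos k - b * cos (mu - k)] at [k = mu] and [k = 0]. *)
Lemma ltr_threshold {R : realFieldType} {a b c : R} : 0 <= b -> b <= a -> a < 1 ->
  (a = 0 -> c = 0) -> c <= 1 -> c < (`|a ^+ 2 - b ^+ 2| + 2 * b) / (2 * a) ->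
  a * c - b < (a ^+ 2 - b ^+ 2) / 2 /\ (a ^+ 2 - b ^+ 2) / 2 < a - b * c.
Proof.
(* For [a = 0] the quotient by zero is 0, as is [c], against the strict inequality. *)
move=> b0 ba a1 ac0 c1; have [a0|a0] := eqVneq a 0.
  by rewrite ac0 // a0 mulr0 invr0 mulr0 ltxx.
have {}a0 : 0 < a by rewrite lt_def a0 (le_trans b0).
have ab2 : b ^+ 2 <= a ^+ 2 by rewrite lerXn2r // nnegrE ltW.
rewrite ger0_norm ?subr_ge0 // ltr_pdivlMr ?mulr_gt0 // => cb.
split; first lra.
move: ba; rewrite le_eqVlt => /orP[/eqP ba|ba]; first by move: cb; rewrite ba; lra.
have : b * c <= b * 1 by exact: ler_wpM2l.
have : 0 < (a - b) * (2 - a - b) by apply: mulr_gt0; lra.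
lra.
Qed.

(** Intermediate value theorem on [[0, mu]]; strictness at both ends keeps [k] in the interior. *)
Lemma exists_angle (R : realType) (a b mu : R) : 0 <= mu ->
  (a ^+ 2 - b ^+ 2) / 2 < a - b * cos mu ->
  a * cos mu - b < (a ^+ 2 - b ^+ 2) / 2 ->
  exists k, 0 < k < mu /\ a * cos k - b * cos (mu - k) = (a ^+ 2 - b ^+ 2) / 2.
Proof.
move=> mu0; set v := _ / 2; pose f k := a * cos k - b * cos (mu - k).
have f0 : f 0 = a - b * cos mu by rewrite /f cos0 subr0 mulr1.
have fmu : f mu = a * cos mu - b by rewrite /f subrr cos0 mulr1.
rewrite -f0 -fmu => vf0 fmuv.
have [|| k] := @IVT R f 0 mu v mu0.
- apply: continuous_subspaceT => t; apply: cvgB; apply: cvgM; try exact: cvg_cst.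
    exact: continuous_cos.
  apply: (@continuous_comp _ _ _ (fun t => mu - t) cos); last exact: continuous_cos.
  by apply: cvgB; [exact: cvg_cst | exact: cvg_id].
- by rewrite ge_min le_max (ltW vf0) (ltW fmuv) orbT.
rewrite in_itv /= => /andP[k0 kmu] fk; exists k; split => //.
rewrite !lt_neqAle k0 kmu !andbT; apply/andP; split; apply/eqP => kE.
  by move: vf0; rewrite kE fk ltxx.
by move: fmuv; rewrite -kE fk ltxx.
Qed.

Theorem theorem3p8 (R : realType) (n : nat) (hn : (2 <= n)%N)
    (x y : 'rV[R]_n) (hx : unit_ball x) (hy : unit_ball y) :
  let mu := angle x y in
  let m := Num.min (enorm x) (enorm y) in
  let M := Num.max (enorm x) (enorm y) in
  let bound := (`|enorm x ^+ 2 - enorm y ^+ 2| + 2 * m) / (2 * M) in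
  let is_k := fun k : R =>
    0 < k < mu /\
    enorm x * cos k - enorm y * cos (mu - k)
      = (enorm x ^+ 2 - enorm y ^+ 2) / 2 in
  (bound <= cos mu ->
     tilde_c (@unit_ball R n) x y = enorm (x - y) / (1 - m)) /\
  (cos mu < bound ->
     (exists k : R, is_k k) /\
     (forall k : R, is_k k ->
        tilde_c (@unit_ball R n) x y
          = enorm (x - y)
            / Num.sqrt (1 + enorm x ^+ 2 - 2 * enorm x * cos k))).
Proof.
move=> mu m M bound is_k.
have [/andP[mu0 mupi] [u [e [uu ee ue xu ye]]]] := planar_frame hn x y.
have x0 := enorm_ge0 x; have y0 := enorm_ge0 y.
have x1 : enorm x < 1 by []; have y1 : enorm y < 1 by [].
have c1 : cos mu <= 1 by exact: cos_le1.
have sqr_le r s : 0 <= s -> r ^+ 2 <= s ^+ 2 -> r <= s :> R.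
  by move=> s0; apply: contraTT; rewrite -!ltNge => sr; nra.
have zz v w : v ^+ 2 + w ^+ 2 = 1 -> dot (v *: u + w *: e) (v *: u + w *: e) = 1.
  by move=> <-; rewrite !dotE uu ee ue (dotC e u) ue; ring.
split=> [bc | cb].
  have [yx|/ltW xy] := leP (enorm y) (enorm x).
    move: bc; rewrite /bound /m /M min_r // max_l // => /(ler_threshold y0 yx) bc.
    apply: (tilde_c_nearest _ ye) => //; first exact/zz/cos2Dsin2.
    apply: sqr_le; first lra.
    rewrite enormB_sqr -enorm_sqr zz ?cos2Dsin2 // {2}xu !dotE uu ue sqrrB; lra.
  (* Now [x] is the shorter vector, so the roles are exchanged by symmetry of [tilde_c]. *)
  move: bc; rewrite /bound /m /M min_l // max_r // distrC.
  move=> /(ler_threshold x0 xy) bc.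
  rewrite tilde_cC enormBC; apply: (tilde_c_nearest _ xu) => //.
  apply: sqr_le; first lra.
  rewrite enormB_sqr -enorm_sqr uu {2}ye !dotE uu (dotC e u) ue sqrrB; lra.
split=> [|k [kmu kP]]; last exact: tilde_c_equidistant uu ee ue xu ye kmu mupi kP.
(* The default angle pi / 2 settles the degenerate case of [ltr_threshold]. *)
have cos0 : enorm x * enorm y = 0 -> cos mu = 0.
  by rewrite /mu /angle => ->; rewrite invr0 mulr0 acos0 cos_pihalf.
have [yx|/ltW xy] := leP (enorm y) (enorm x).
  move: cb; rewrite /bound /m /M min_r // max_l // => cb.
  have [|? ?] := ltr_threshold y0 yx x1 _ c1 cb.
    by move=> x00; apply: cos0; rewrite x00 mul0r.
  exact: exists_angle.
move: cb; rewrite /bound /m /M min_l // max_r // distrC => cb.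
have [|? ?] := ltr_threshold x0 xy y1 _ c1 cb.
  by move=> y00; apply: cos0; rewrite y00 mulr0.
(* Exchanging [x] and [y] negates the two inequalities and swaps the endpoints. *)
by apply: exists_angle => //; lra.
Qed.
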